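(* For every $K_1,K_2,\ldots,K_n\in\mathcal{K}_0^n$ we have $$V^{\clubsuit}(K_1,K_2,K_3,\ldots,K_n)^2\le V^{\clubsuit}(K_1,K_1,K_3,\ldots,K_n)\cdot V^{\clubsuit}(K_2,K_2,K_3,\ldots,K_n),$$ as well as $$V^{\clubsuit}(K_1,K_2,\ldots,K_n)\le\left(\prod_{i=1}^n\left|K_i^{\clubsuit}\right|\right)^{\frac1n}.$$
   Context: A convex body in $\mathbb{R}^n$ is a closed convex set $K\subseteq\mathbb{R}^n$ with $0\in K$ (not assumed compact, nor with non-empty interior); $\mathcal{K}_0^n$ is the set of all convex bodies. The support function of $K$ is $h_K:S^{n-1}\to[0,\infty]$, $h_K(\theta)=\sup_{x\in K}\langle x,\theta\rangle$. A star set is a non-empty $A\subseteq\mathbb{R}^n$ such that $x\in A$ and $0\le\lambda\le1$ imply $\lambda x\in A$; its radial function is $r_A(\theta)=\sup\{\lambda\ge0:\lambda\theta\in A\}\in[0,\infty]$. A star body is a star set $A$ with $r_A(\theta)\theta\in A$ for all $\theta\in S^{n-1}$ with $r_A(\theta)<\infty$; it is uniquely determined by $r_A$. For $K\in\mathcal{K}_0^n$, the flower $K^{\clubsuit}$ is the star body with radial function $r_{K^{\clubsuit}}=h_K$. $|\cdot|$ is volume on $\mathbb{R}^n$, $B_2^n$ is the unit Euclidean ball, $\sigma$ is the uniform probability measure on $S^{n-1}$, and $V^{\clubsuit}(K_1,\ldots,K_n)=\left|B_2^n\right|\cdot\int_{S^{n-1}}h_{K_1}(\theta)h_{K_2}(\theta)\cdots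 h_{K_n}(\theta)\,\mathrm{d}\sigma(\theta)$. Quantities take values in $[0,\infty]$, with the usual measure-theoretic convention $0\cdot\infty=0$. *)

(* Defs.v *)
From HB Require Import structures.
From mathcomp Require Import all_boot all_order all_algebra.
From mathcomp Require Import all_classical all_reals all_analysis.
From mathcomp Require Import measurable_realfun.

Set Implicit Arguments.
Unset Strict Implicit.
Unset Printing Implicit Defensive.
Import Order.TTheory GRing.Theory Num.Theory.
Import numFieldNormedType.Exports.

Local Open Scope classical_set_scope.
Local Open Scope ring_scope.

Definition rV_display : measure_display -> measure_display.
Proof. exact. Qed.

(* 'rV_n gets the product sigma-algebra, generated by the coordinates, as
   n.-tuple T does in the library; over the reals this is the Borel
   sigma-algebra. *)
Section measurable_rV.
Context {d : measure_display} {T : measurableType d} (n : nat).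

Definition rV_coord (i : 'I_n) (x : 'rV[T]_n) : T := x ord0 i.

HB.instance Definition _ := @isMeasurable.Build (rV_display d)
  'rV[T]_n (g_sigma_preimage rV_coord)
  (@sigma_algebra0 _ _ _) (@sigma_algebraC _ _)
  (@sigma_algebra_bigcup _ _ _).

End measurable_rV.

Section measurable_rV_theory.
Context {d d' : measure_display} {T : measurableType d} {T' : measurableType d'}.

Lemma measurable_rV_coord n (i : 'I_n) :
  measurable_fun [set: 'rV[T]_n] (fun x => x ord0 i).
Proof.
move=> _ Y mY; rewrite setTI; apply: sub_sigma_algebra => /=.
rewrite -bigcup_seq/=; exists i => /=; first by rewrite mem_index_enum.
by exists Y => //; rewrite setTI.
Qed.

Lemma measurable_rVP n (f : T' -> 'rV[T]_n) :
  (forall i, measurable_fun setT (fun t => f t ord0 i)) ->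
  measurable_fun setT f.
Proof.
move=> mf _ Y mY; rewrite setTI.
suff : @measurable _ 'rV[T]_n `<=` [set Y | measurable (f @^-1` Y)] by apply.
apply: smallest_sub.
- split => /=; first by rewrite preimage_set0.
  + by move=> A mA; rewrite setTD preimage_setC; exact: measurableC.
  + by move=> F mF; rewrite preimage_bigcup; exact: bigcupT_measurable.
- rewrite -bigcup_seq => _ [i _ [A mA <-]] /=.
  by have := mf i measurableT A mA; rewrite !setTI.
Qed.

End measurable_rV_theory.

Section lebesgue_rV.
Context {R : realType}.

Definition rV_cons n (p : R * 'rV[R]_n) : 'rV[R]_n.+1 :=
  \row_i oapp (p.2 ord0) p.1 (unlift ord0 i).

Fixpoint volume n : set 'rV[R]_n -> \bar R :=
  if n is m.+1 then
    pushforward (lebesgue_measure \x @volume m)%E (@rV_cons m)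
  else \d_ (0 : 'rV[R]_0).

Lemma rV_cons0 n (p : R * 'rV[R]_n) : rV_cons p ord0 ord0 = p.1.
Proof. by rewrite mxE unlift_none. Qed.

Lemma rV_consS n (p : R * 'rV[R]_n) i :
  rV_cons p ord0 (lift ord0 i) = p.2 ord0 i.
Proof. by rewrite mxE liftK. Qed.

Lemma measurable_rV_cons n : measurable_fun setT (@rV_cons n).
Proof.
apply: measurable_rVP => i.
have [j ->|->] := unliftP ord0 i; last first.
  by rewrite (_ : (fun _ => _) = fst) //; apply/funext => p; rewrite rV_cons0.
rewrite (_ : (fun _ => _) = (fun x : 'rV[R]_n => x ord0 j) \o snd); last first.
  by apply/funext => p; rewrite rV_consS.
by apply: measurableT_comp => //; exact: measurable_rV_coord.
Qed.

Let rV_uncons n (x : 'rV[R]_n.+1) : R * 'rV[R]_n :=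
  (x ord0 ord0, \row_i x ord0 (lift ord0 i)).

Let rV_consK n : cancel (@rV_cons n) (@rV_uncons n).
Proof.
move=> [a y]; congr pair; first by rewrite rV_cons0.
by apply/rowP => i; rewrite mxE rV_consS.
Qed.

Let rV_unconsK n : cancel (@rV_uncons n) (@rV_cons n).
Proof.
move=> x; apply/rowP => i.
have [j ->|->] := unliftP ord0 i; last by rewrite rV_cons0.
by rewrite rV_consS mxE.
Qed.

Let measurable_rV_uncons n : measurable_fun setT (@rV_uncons n).
Proof.
apply: measurable_fun_pair => /=; first exact: measurable_rV_coord.
apply: measurable_rVP => i.
rewrite (_ : (fun _ => _) = (fun x : 'rV[R]_n.+1 => x ord0 (lift ord0 i))).
  exact: measurable_rV_coord.
by apply/funext => x; rewrite mxE.
Qed.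

Let volume_ex n : exists m : {sigma_finite_measure set 'rV[R]_n -> \bar R},
  m = @volume n :> (set _ -> _).
Proof.
elim: n => [|n [m mE]].
  by exists (\d_ (0 : 'rV[R]_0)).
have mcons := @measurable_rV_cons n.
have v0 : volume (set0 : set 'rV[R]_n.+1) = 0%E.
  rewrite /= -mE /pushforward preimage_set0; exact: measure0.
have vge0 (A : set 'rV[R]_n.+1) : (0 <= volume A)%E.
  rewrite /= -mE /pushforward; exact: measure_ge0.
have vadd : semi_sigma_additive (@volume n.+1).
  move=> F mF tF mUF; rewrite /= -mE /pushforward preimage_bigcup.
  apply: measure_semi_sigma_additive.
  - by move=> k; rewrite -[X in measurable X]setTI; exact: mcons.
  - apply/trivIsetP => /= i j _ _ ij; rewrite -preimage_setI.
    by move/trivIsetP : tF => /(_ _ _ _ _ ij) ->//; rewrite preimage_set0.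
  - by rewrite -preimage_bigcup -[X in measurable X]setTI; exact: mcons.
have vfin : sigma_finite setT (@volume n.+1).
  have /sigma_finiteP[F [UF ndF Foo]] := sigma_finiteT (@lebesgue_measure R).
  have /sigma_finiteP[G [UG ndG Goo]] := sigma_finiteT m.
  exists (fun k => (@rV_uncons n) @^-1` (F k `*` G k)).
    rewrite -preimage_bigcup -[LHS](preimage_setT (@rV_uncons n)).
    congr (_ @^-1` _); apply/seteqP; split => // -[x y] _.
    have [i _ Fx] : (\bigcup_i F i) x by rewrite -UF.
    have [j _ Gy] : (\bigcup_i G i) y by rewrite -UG.
    exists (maxn i j) => //; split.
    - by move: x Fx; exact/subsetPset/ndF/leq_maxl.
    - by move: y Gy; exact/subsetPset/ndG/leq_maxr.
  move=> k; have [mF Foo'] := Foo k; have [mG Goo'] := Goo k; split.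
    rewrite -[X in measurable X]setTI; apply: measurable_rV_uncons => //.
    exact: measurableX.
  rewrite /= -mE /pushforward -comp_preimage (_ : _ \o _ = id); last first.
    by apply/funext => p /=; rewrite rV_consK.
  rewrite preimage_id product_measure1E//.
  by rewrite lte_mul_pinfty// ge0_fin_numE.
pose mu0 : {measure set 'rV[R]_n.+1 -> \bar R} :=
  HB.pack (@volume n.+1) (isMeasure.Build _ _ _ (@volume n.+1) v0 vge0 vadd).
pose mu : {sigma_finite_measure set 'rV[R]_n.+1 -> \bar R} :=
  HB.pack (Measure.sort mu0) (@Measure_isSigmaFinite.Build _ _ _ mu0 vfin).
by exists mu.
Qed.

Let volume0 n : @volume n set0 = 0%E.
Proof. by have [m <-] := volume_ex n; exact: measure0. Qed.

Let volume_ge0 n A : (0 <= @volume n A)%E.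
Proof. by have [m <-] := volume_ex n; exact: measure_ge0. Qed.

Let volume_additive n : semi_sigma_additive (@volume n).
Proof. by have [m <-] := volume_ex n; exact: measure_semi_sigma_additive. Qed.

HB.instance Definition _ n := isMeasure.Build _ _ _ (@volume n)
  (@volume0 n) (@volume_ge0 n) (@volume_additive n).

Let volume_sigma_finite n : sigma_finite setT (@volume n).
Proof. by have [m <-] := volume_ex n; exact: sigma_finiteT. Qed.

HB.instance Definition _ n := Measure_isSigmaFinite.Build _ _ _ (@volume n)
  (@volume_sigma_finite n).

Lemma measurable_box n (A : 'I_n -> set R) : (forall i, measurable (A i)) ->
  measurable [set x : 'rV[R]_n | forall i, A i (x ord0 i)].
Proof.
move=> mA; rewrite (_ : [set _ | _] = \bigcap_(i in [set: 'I_n])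
    ((fun x : 'rV[R]_n => x ord0 i) @^-1` A i)); last first.
  by apply/seteqP; split => [x xA i _|x xA i] /=; exact: xA.
apply: fin_bigcap_measurable => // i _.
by rewrite -[X in measurable X]setTI; exact: measurable_rV_coord.
Qed.

Lemma volume_box n (A : 'I_n -> set R) : (forall i, measurable (A i)) ->
  volume [set x : 'rV[R]_n | forall i, A i (x ord0 i)] =
  (\prod_(i < n) lebesgue_measure (A i))%E.
Proof.
elim: n A => [|n ih] A mA.
  rewrite big_ord0 /= diracE mem_set//=; by case.
rewrite big_ord_recl -ih; last by move=> i; exact: mA.
rewrite -product_measure1E; [|exact: mA|]; last first.
  by apply: (@measurable_box _ (fun i => A (lift ord0 i))) => i; exact: mA.
rewrite [LHS]/= /pushforward; congr (_ _).
apply/seteqP; split => [[a y] /= h|[a y] /= [ha hy] i].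
  split; first by have := h ord0; rewrite rV_cons0.
  by move=> i; have := h (lift ord0 i); rewrite rV_consS.
by have [j ->|->] := unliftP ord0 i; rewrite ?rV_cons0 ?rV_consS.
Qed.

End lebesgue_rV.

Section euclidean.
Context {R : realType}.

Definition dotp n (x y : 'rV[R]_n) : R := \sum_(i < n) x ord0 i * y ord0 i.

(* The norm `|x| that the library puts on 'rV_n is the sup norm; it induces the
   usual topology, but not the Euclidean ball and sphere. *)
Definition enorm n (x : 'rV[R]_n) : R := Num.sqrt (dotp x x).

Definition eball n : set 'rV[R]_n := [set x | enorm x <= 1].

Definition esphere n : set 'rV[R]_n := [set x | enorm x = 1].

Definition direction n (x : 'rV[R]_n) : 'rV[R]_n := (enorm x)^-1 *: x.

(* The uniform probability measure on the unit sphere, as a measure on 'rV_n: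
   the mass of A is the fraction of the volume of the unit ball that lies in
   the cone over A. *)
Definition sphere_measure n (A : set 'rV[R]_n) :=
  (((fine (volume (@eball n)))^-1)%:E *
   volume (@eball n `&` @direction n @^-1` A))%E.

Lemma measurable_enorm n : measurable_fun setT (@enorm n).
Proof.
rewrite (_ : @enorm n = Num.sqrt \o (fun x => dotp x x)) //.
apply: measurableT_comp; last first.
  by apply: measurable_sum => i; apply: measurable_funM;
    exact: measurable_rV_coord.
by apply: continuous_measurable_fun; exact: sqrt_continuous.
Qed.

Lemma measurable_eball n : measurable (@eball n).
Proof.
rewrite (_ : @eball n = @enorm n @^-1` [set x | x \in `]-oo, 1]]); last first.
  by apply/seteqP; split => x /=; rewrite in_itv.
rewrite -[X in measurable X]setTI; apply: measurable_enorm => //.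
Qed.

Lemma measurable_esphere n : measurable (@esphere n).
Proof.
rewrite (_ : @esphere n = @enorm n @^-1` [set 1]) //.
by rewrite -[X in measurable X]setTI; exact: measurable_enorm.
Qed.

Lemma measurable_direction n : measurable_fun setT (@direction n).
Proof.
apply: measurable_rVP => i.
rewrite (_ : (fun _ => _) = (fun x => enorm x `^ (-1) * x ord0 i)); last first.
  by apply/funext => x; rewrite mxE powR_inv1// sqrtr_ge0.
apply: measurable_funM; last exact: measurable_rV_coord.
by apply: (measurableT_comp (measurable_powR _)); exact: measurable_enorm.
Qed.

Let volume_eball_ge0 n : 0 <= (fine (volume (@eball n)))^-1.
Proof. by rewrite invr_ge0 fine_ge0. Qed.

Let cone_measure n : {measure set 'rV[R]_n -> \bar R} :=
  measure_function_pushforward__canonical__measure_function_Measure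
    (mrestr (@volume R n) (@measurable_eball n)) (@measurable_direction n).

Let sphere_measure0 n : @sphere_measure n set0 = 0%E.
Proof. by rewrite /sphere_measure preimage_set0 setI0 measure0 mule0. Qed.

Let sphere_measure_ge0 n A : (0 <= @sphere_measure n A)%E.
Proof. by rewrite mule_ge0// lee_fin. Qed.

Let sphere_measure_additive n : semi_sigma_additive (@sphere_measure n).
Proof.
rewrite (_ : @sphere_measure n =
    mscale (NngNum (volume_eball_ge0 n)) (cone_measure n)).
  exact: measure_semi_sigma_additive.
by apply/funext => A; rewrite /sphere_measure setIC.
Qed.

HB.instance Definition _ n := isMeasure.Build _ _ _ (@sphere_measure n)
  (@sphere_measure0 n) (@sphere_measure_ge0 n) (@sphere_measure_additive n).

End euclidean.

Section flowers.
Context {R : realType} {n : nat}.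
Implicit Types (K A B : set 'rV[R]_n) (x theta : 'rV[R]_n).

Definition convex_body K := [/\ closed K, convex_set K & K 0].

Definition support K theta : \bar R :=
  ereal_sup [set (dotp x theta)%:E | x in K].

Definition star_set A :=
  A !=set0 /\ forall x (l : R), A x -> 0 <= l <= 1 -> A (l *: x).

Definition radial A theta : \bar R :=
  ereal_sup [set l%:E | l in [set l : R | 0 <= l /\ A (l *: theta)]].

Definition star_body A := star_set A /\
  forall theta, @esphere R n theta -> (radial A theta < +oo)%E ->
    A (fine (radial A theta) *: theta).

Definition is_flower K A := star_body A /\
  forall theta, @esphere R n theta -> radial A theta = support K theta.

(* The star body with radial function [support K]; [flowerP] and
   [flower_unique] show that it exists and is unique. *)
Definition flower K : set 'rV[R]_n := get (is_flower K).

Definition mixed_flower_volume (K : 'I_n -> set 'rV[R]_n) : \bar R :=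
  (volume (@eball R n) *
   \int[@sphere_measure R n]_(theta in @esphere R n)
     \prod_(i < n) support (K i) theta)%E.

Lemma enormZ (l : R) x : enorm (l *: x) = `|l| * enorm x.
Proof.
rewrite /enorm /dotp; under eq_bigr do rewrite !mxE mulrACA -expr2.
by rewrite -mulr_sumr sqrtrM ?sqr_ge0// sqrtr_sqr.
Qed.

Lemma enorm_ge0 x : 0 <= enorm x. Proof. exact: sqrtr_ge0. Qed.

Lemma enorm_eq0 x : (enorm x == 0) = (x == 0).
Proof.
apply/eqP/eqP => [/eqP|->]; last first.
  by rewrite /enorm /dotp big1 ?sqrtr0// => i _; rewrite mxE mul0r.
rewrite sqrtr_eq0 => x0; apply/rowP => i; rewrite mxE; apply/eqP.
have xx0 j : true -> 0 <= x ord0 j * x ord0 j by rewrite -expr2 sqr_ge0.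
have /eqP : dotp x x = 0 by apply/eqP; rewrite eq_le x0 sumr_ge0.
by rewrite psumr_eq0// => /allP/(_ i (mem_index_enum _)); rewrite /= mulf_eq0 orbb.
Qed.

Lemma enorm_gt0 x : (0 < enorm x) = (x != 0).
Proof. by rewrite lt_neqAle enorm_ge0 andbT eq_sym enorm_eq0. Qed.

Lemma direction_esphere x : x != 0 -> @esphere R n (direction x).
Proof.
by move=> x0; rewrite /esphere/= enormZ normfV (ger0_norm (enorm_ge0 x))
  mulVf// enorm_eq0.
Qed.

Lemma directionK x : enorm x *: direction x = x.
Proof.
have [->|x0] := eqVneq x 0; first by rewrite /direction !scaler0.
by rewrite scalerA divff ?scale1r// enorm_eq0.
Qed.

Lemma directionZ (l : R) x : 0 < l -> direction (l *: x) = direction x.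
Proof.
move=> l0; rewrite /direction enormZ gtr0_norm// scalerA invfM mulrAC.
by rewrite mulVf ?mul1r// gt_eqF.
Qed.

Lemma direction_sphere theta : @esphere R n theta -> direction theta = theta.
Proof. by rewrite /esphere/direction/= => ->; rewrite invr1 scale1r. Qed.

Lemma support_ge0 K theta : K 0 -> (0 <= support K theta)%E.
Proof.
move=> K0; apply: ereal_sup_ubound; exists 0 => //.
by rewrite /dotp big1// => i _; rewrite mxE mul0r.
Qed.

Lemma support0 K : K 0 -> support K 0 = 0%E.
Proof.
move=> K0; apply/eqP; rewrite eq_le support_ge0// andbT.
apply: ge_ereal_sup => _ [x _ <-].
by rewrite /dotp big1// => i _; rewrite mxE mulr0.
Qed.

Lemma star_set0 A : star_set A -> A 0.
Proof. by move=> [[x Ax] /(_ x 0 Ax)]; rewrite scale0r lexx ler01; apply. Qed.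

Lemma star_bodyP A x : star_body A -> x != 0 ->
  A x <-> ((enorm x)%:E <= radial A (direction x))%E.
Proof.
move=> [stA rA] x0; split => [Ax|].
  apply: ereal_sup_ubound; exists (enorm x) => //.
  by split; [exact: enorm_ge0|rewrite directionK].
have x_gt0 : 0 < enorm x by rewrite enorm_gt0.
have scal l : enorm x <= l -> A (l *: direction x) -> A x.
  move=> xl Al; have l0 : 0 < l by exact: lt_le_trans xl.
  have := stA.2 _ (enorm x / l) Al; rewrite scalerA divfK ?gt_eqF// directionK.
  by apply; rewrite divr_ge0 ?enorm_ge0 ?(ltW l0)//= ler_pdivrMr// mul1r.
have [roo|/negP roo xr] := boolP (radial A (direction x) < +oo)%E.
  have := rA _ (direction_esphere x0) roo.
  case: (radial A (direction x)) roo => [r| |] //= _ Ar.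
  by rewrite lee_fin => /scal; exact.
have : ((enorm x)%:E < radial A (direction x))%E.
  by rewrite lt_neqAle xr andbT; apply/eqP => e; apply: roo; rewrite -e ltry.
move=> /ereal_sup_gt[_ [l [_ Al] <-]]; rewrite lte_fin => /ltW xl.
exact: scal xl Al.
Qed.

Lemma flower_unique K A B : is_flower K A -> is_flower K B -> A = B.
Proof.
move=> [sA rA] [sB rB]; apply/seteqP; split => x.
  have [-> _|x0] := eqVneq x 0; first exact: star_set0 sB.1.
  by rewrite !star_bodyP// rA ?rB//; exact: direction_esphere.
have [-> _|x0] := eqVneq x 0; first exact: star_set0 sA.1.
by rewrite !star_bodyP// rA ?rB//; exact: direction_esphere.
Qed.

Let flower_ex K : K 0 ->
  is_flower K [set x | ((enorm x)%:E <= support K (direction x))%E].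
Proof.
move=> K0; set A := [set x | _].
have A0 : A 0.
  by rewrite /A/= /direction scaler0 support0// (eqP (_ : enorm 0 == 0)) ?enorm_eq0.
have AZ (l : R) theta : @esphere R n theta -> 0 <= l ->
    A (l *: theta) <-> (l%:E <= support K theta)%E.
  move=> t1; rewrite le_eqVlt => /orP[/eqP <-|l0].
    by rewrite scale0r; split=> // _; exact: support_ge0.
  rewrite /A/= directionZ// direction_sphere// enormZ gtr0_norm//.
  by rewrite (t1 : enorm theta = 1) mulr1.
have rA theta : @esphere R n theta -> radial A theta = support K theta.
  move=> t1; apply/eqP; rewrite eq_le; apply/andP; split.
    by apply: ge_ereal_sup => _ [l [l0 /AZ h] <-]; exact: h.
  have := support_ge0 theta K0.
  case s : (support K theta) => [r| |]// => [r0|_].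
    apply: ereal_sup_ubound; exists r => //; split => //.
    by apply/AZ => //; rewrite s.
  rewrite leye_eq; apply/eqP/eq_infty => r.
  apply: (@le_trans _ _ (`|r|)%:E); first by rewrite lee_fin ler_norm.
  apply: ereal_sup_ubound; exists `|r| => //; split => //.
  by apply/AZ => //; rewrite s leey.
split => //; split; first split; first by exists 0.
  move=> x l Ax /andP[]; rewrite le_eqVlt => /orP[/eqP <- _|l0 l1].
    by rewrite scale0r.
  rewrite /A/= directionZ// enormZ gtr0_norm//.
  by apply: le_trans Ax; rewrite lee_fin ler_piMl// enorm_ge0.
move=> theta t1; rewrite rA// => soo.
have s0 := support_ge0 theta K0.
have sfin : support K theta \is a fin_num by rewrite ge0_fin_numE.
by apply/AZ => //; rewrite ?fine_ge0// fineK.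
Qed.

Lemma flowerP K : K 0 -> is_flower K (flower K).
Proof. by move=> /flower_ex FK; exact: (getPex (ex_intro _ _ FK)). Qed.

Lemma flowerE K : K 0 ->
  flower K = [set x | ((enorm x)%:E <= support K (direction x))%E].
Proof. by move=> K0; exact: flower_unique (flowerP K0) (flower_ex K0). Qed.

End flowers.

Section sphere_mass.
Context {R : realType}.

Lemma volume_eball_lty n : (volume (@eball R n) < +oo)%E.
Proof.
pose A (i : 'I_n) : set R := `[-1, 1]%classic.
have mA i : measurable (A i) by exact: measurable_itv.
apply: (@le_lt_trans _ _ (volume [set x : 'rV[R]_n | forall i, A i (x ord0 i)])).
  apply: le_measure; rewrite ?inE; [exact: measurable_eball|
    exact: measurable_box|move=> x x1 i].
  rewrite /A/= in_itv/= -ler_norml; apply: le_trans x1.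
  rewrite -sqrtr_sqr ler_wsqrtr// /dotp (bigD1 i)//= -expr2 lerDl sumr_ge0// => j _.
  by rewrite -expr2 sqr_ge0.
rewrite volume_box// -ge0_fin_numE; last by apply: prode_ge0.
by apply: prode_fin_num => i _; rewrite lebesgue_measure_itv/=; case: ifP.
Qed.

Lemma volume_eball_gt0 n : (0 < volume (@eball R n))%E.
Proof.
pose e : R := n.+1%:R^-1.
have e0 : 0 < e by rewrite invr_gt0.
pose A (i : 'I_n) : set R := `[- e, e]%classic.
have mA i : measurable (A i) by exact: measurable_itv.
apply: (@lt_le_trans _ _ (volume [set x : 'rV[R]_n | forall i, A i (x ord0 i)])).
  rewrite volume_box//; elim/big_ind : _ => //= [x y|i _]; first exact: mule_gt0.
  by rewrite lebesgue_measure_itv/= lte_fin gtrN// -EFinD lte_fin opprK addr_gt0.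
apply: le_measure; rewrite ?inE; [exact: measurable_box|
  exact: measurable_eball|move=> x xA].
rewrite /eball/= -[leRHS]sqrtr1 ler_wsqrtr//.
apply: (@le_trans _ _ (\sum_(i < n) e)).
  apply: ler_sum => i _; have := xA i; rewrite /A/= in_itv/= -ler_norml => xe.
  rewrite -expr2 -real_normK ?num_real// expr2.
  apply: (@le_trans _ _ (e * 1)); last by rewrite mulr1.
  apply: ler_pM => //; apply: le_trans xe _.
  by rewrite invf_le1// ler1n.
rewrite sumr_const card_ord -mulr_natl ler_pdivrMr ?mul1r ?ler_nat//.
Qed.

Lemma sphere_measure_setT n : (0 < n)%N ->
  sphere_measure [set: 'rV[R]_n] = 1%E.
Proof.
move=> n0; rewrite /sphere_measure preimage_setT setIT.
have : volume (@eball R n) \is a fin_num.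
  by rewrite ge0_fin_numE// volume_eball_lty.
have := volume_eball_gt0 n; case: (volume _) => [r| |]//=; rewrite lte_fin => r0 _.
by rewrite -EFinM mulVf// gt_eqF.
Qed.

Lemma sphere_measure_esphere n : (0 < n)%N ->
  sphere_measure (@esphere R n) = 1%E.
Proof.
move=> n0; rewrite -(sphere_measure_setT n0) /sphere_measure; congr (_ * _)%E.
rewrite preimage_setT setIT.
have -> : @eball R n `&` @direction R n @^-1` @esphere R n = @eball R n `\ 0.
  apply/seteqP; split => x /= [x1 xd]; split => //.
    move=> x0; move: xd; rewrite x0 /direction scaler0 /esphere/=.
    have /eqP -> : enorm (0 : 'rV[R]_n) == 0 by rewrite enorm_eq0.
    by move/esym/eqP; rewrite oner_eq0.
  by apply: direction_esphere; exact/eqP.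
pose Z (i : 'I_n) : set R := [set 0].
have mZ i : measurable (Z i) by exact: measurable_set1.
have E0 : [set 0] = [set x : 'rV[R]_n | forall i, Z i (x ord0 i)].
  apply/seteqP; split => [_ -> i|x x0]; first by rewrite /Z mxE.
  by apply/rowP => i; rewrite mxE; exact: x0.
have mn0 : measurable [set (0 : 'rV[R]_n)].
  by rewrite E0; exact: measurable_box.
have v0 : volume [set (0 : 'rV[R]_n)] = 0%E.
  rewrite E0 volume_box//; case: n n0 @Z mZ {E0 mn0} => // n _ Z mZ.
  by rewrite big_ord_recl lebesgue_measure_set1 mul0e.
rewrite measureD//; [|exact: measurable_eball|exact: volume_eball_lty].
rewrite [X in (_ - X)%E](_ : _ = 0%E) ?sube0//.
apply/eqP; rewrite eq_le measure_ge0 andbT -v0.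
by apply: le_measure; rewrite ?inE//; apply: measurableI => //;
  exact: measurable_eball.
Qed.

End sphere_mass.

(* Main.v *)
Require Import Defs.
From mathcomp Require Import all_boot all_order all_algebra.
From mathcomp Require Import all_classical all_reals all_analysis.
From mathcomp Require Import measurable_realfun.

Set Implicit Arguments.
Unset Strict Implicit.
Unset Printing Implicit Defensive.
Import Order.TTheory GRing.Theory Num.Theory.
Import numFieldNormedType.Exports.

Local Open Scope classical_set_scope.
Local Open Scope ring_scope.

(** Both inequalities are instances of one Hoelder inequality
    ([integral_prod_holder]): if nonnegative functions satisfy
    u ^ m <= g_1 ... g_m pointwise, then
    (int u) ^ m <= (int g_1) ... (int g_m).  It follows from the inequality
    of arithmetic and geometric means once each g_i is divided by its
    integral.  The pointwise hypothesis, in place of roots of the g_i, lets both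
    inequalities be read off from identities between products, which hold on
    all of [0, +oo] with 0 * oo = 0.

    Applied to products of support functions on the sphere, it bounds
    V(K) ^ m by a product of m mixed volumes V(L_j) as soon as the
    corresponding products of support functions compare pointwise
    ([mixed_flower_volume_holder]).  For m = 2, the squared product
    (h_1 h_2 w) ^ 2, with w = h_3 ... h_n, equals (h_1 h_1 w) (h_2 h_2 w), which
    is the first inequality.  For m = n, the power (h_1 ... h_n) ^ n equals the product of
    the h_j ^ n, which gives V(K_1, ..., K_n) ^ n <= prod_j V(K_j, ..., K_j).

    It remains to compare V(K, ..., K) = |B| int h_K ^ n with the volume of
    the flower of K ([flower_volume_ge]).  Integration in polar coordinates
    makes them equal, but the inequality that is needed only uses the volume
    of a cone truncated at a fixed radius, a consequence of the
    n-homogeneity of volume ([volume_cone]): a simple function below h_K ^ n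
    determines finitely many disjoint truncated cones inside the flower,
    whose total volume is |B| times the integral of the simple function. *)

(** * Powers and products in the extended reals *)

Lemma prode_constE (R : realType) (n : nat) (x : \bar R) :
  (\prod_(i < n) x = x ^+ n)%E.
Proof. by rewrite big_const_ord iter_mule mule1. Qed.

Lemma prode_expe (R : realType) (n m : nat) (f : 'I_m -> \bar R) :
  ((\prod_(i < m) f i) ^+ n = \prod_(i < m) f i ^+ n)%E.
Proof.
rewrite -prode_constE exchange_big/=; apply: eq_bigr => i _.
exact: prode_constE.
Qed.

Lemma expeMn (R : realType) (n : nat) (x y : \bar R) :
  ((x * y) ^+ n = x ^+ n * y ^+ n)%E.
Proof. by rewrite -!prode_constE big_split. Qed.

Lemma lee_prode (R : realType) (n : nat) (f g : 'I_n -> \bar R) :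
  (forall i, 0 <= f i <= g i)%E -> (\prod_(i < n) f i <= \prod_(i < n) g i)%E.
Proof.
move=> fg; suff /andP[] : (0 <= \prod_(i < n) f i <= \prod_(i < n) g i)%E by [].
elim/big_ind2 : _ => // [|x y x' y' /andP[x0 xy] /andP[x'0 xy']].
  by rewrite lee01 lexx.
by rewrite mule_ge0//= lee_pmul.
Qed.

Lemma lee_expe (R : realType) (n : nat) (x y : \bar R) :
  (0 <= x -> x <= y -> x ^+ n <= y ^+ n)%E.
Proof.
move=> x0 xy; elim: n => [|n ih]; first by rewrite !expe0.
by rewrite !expeS lee_pmul// expe_ge0.
Qed.

(** The n-th root inverts the n-th power on the whole of [0, +oo], so that
    inequalities between n-th powers can be turned into inequalities with
    roots, infinite values included. *)
Lemma expe_poweRK (R : realType) (n : nat) (x : \bar R) :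
  (0 < n)%N -> (0 <= x -> (x ^+ n) `^ n%:R^-1 = x)%E.
Proof.
move=> n0; have n0R : n%:R^-1 != 0 :> R by rewrite invr_eq0 pnatr_eq0 -lt0n.
case: x => [r| |]//.
  rewrite lee_fin => r0; rewrite -EFin_expe poweR_EFin -powR_mulrn// -powRrM.
  by rewrite divff ?pnatr_eq0 -?lt0n// powRr1.
move=> _; case: n n0 n0R => // n _ n0R.
rewrite (_ : +oo ^+ n.+1 = +oo)%E ?poweRyr//.
by rewrite expeS gt0_mulye// expe_gt0.
Qed.

Lemma le_expe_poweR (R : realType) (n : nat) (x y : \bar R) :
  (0 < n)%N -> (0 <= x -> x ^+ n <= y -> x <= y `^ n%:R^-1)%E.
Proof.
move=> n0 x0 xy; rewrite -[leLHS](expe_poweRK n0 x0).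
have xn0 := expe_ge0 n x0.
apply: gt0_ler_poweR => //; rewrite in_itv/= ?leey ?andbT//.
exact: le_trans xy.
Qed.

(** * A Hoelder inequality *)

Lemma measurable_prode d (T : measurableType d) (R : realType) (D : set T)
    (m : nat) (f : 'I_m -> T -> \bar R) :
  (forall i, measurable_fun D (f i)) ->
  measurable_fun D (fun x => \prod_(i < m) f i x)%E.
Proof.
move=> mf; elim: m f mf => [|m ih] f mf.
  by under eq_fun do rewrite big_ord0; exact: measurable_cst.
under eq_fun do rewrite big_ord_recl.
by apply: emeasurable_funM => //; exact: ih.
Qed.

(** The inequality of arithmetic and geometric means for the ratios y_i / a_i,
    where c is the geometric mean of the a_i.  If some y_i is infinite, so is
    the right-hand side; otherwise u is finite too and the real inequality
    applies. *)
Lemma le_scaled_arithmetic_mean (R : realType) (m : nat) (c : R) (a : 'I_m -> R)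
    (y : 'I_m -> \bar R) (u : \bar R) :
  (0 < m)%N -> 0 < c -> (forall i, 0 < a i) -> c ^+ m = \prod_(i < m) a i ->
  (0 <= u)%E -> (forall i, 0 <= y i)%E -> (u ^+ m <= \prod_(i < m) y i)%E ->
  (u <= c%:E * \sum_(i < m) (m%:R^-1 / a i)%:E * y i)%E.
Proof.
move=> m0 c0 a0 cm u0 y0 uy.
have w0 i : 0 < m%:R^-1 / a i by rewrite divr_gt0 ?invr_gt0 ?ltr0n.
have t0 i : (0 <= (m%:R^-1 / a i)%:E * y i)%E.
  by apply: mule_ge0 => //; rewrite lee_fin; exact: ltW.
have [/existsP[i /eqP yi]|] := boolP [exists i, y i == +oo%E].
  rewrite (bigD1 i)//= yi gt0_muley ?lte_fin// addye; last first.
    by rewrite gt_eqF// (lt_le_trans ltNy0)// sume_ge0.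
  by rewrite gt0_muley ?lte_fin// leey.
move=> /existsPn yfin.
have yE i : y i = (fine (y i))%:E.
  by rewrite fineK// ge0_fin_numE// ltey.
have ufin : u \is a fin_num.
  rewrite ge0_fin_numE// ltey; apply: contraPneq uy => ->; apply/negP.
  rewrite -ltNge.
  under eq_bigr do rewrite yE.
  rewrite prodEFin (_ : +oo ^+ m = +oo)%E ?ltry//.
  by case: (m) m0 => // k _; rewrite expeS gt0_mulye ?expe_gt0.
rewrite -(fineK ufin); rewrite -(fineK ufin) in u0 uy.
have z0 i : 0 <= fine (y i) by rewrite fine_ge0.
move: uy u0; set v := fine u; rewrite lee_fin.
under eq_bigr do rewrite yE.
under [X in _ -> _ -> (_ <= _ * X)%E]eq_bigr do rewrite yE -EFinM.
rewrite -EFin_expe prodEFin sumEFin -EFinM !lee_fin => vz v0.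
have := @leif_AGM R 'I_m predT (fun i => fine (y i) / a i).
rewrite (_ : #|_| = m); last by rewrite cardT size_enum_ord.
move=> /(_ (fun i _ => divr_ge0 (z0 i) (ltW (a0 i))))[+ _].
set S := (X in _ <= X ^+ _ -> _) => AG.
have -> : \sum_(i < m) m%:R^-1 / a i * fine (y i) = S.
  rewrite /S mulr_suml; apply: eq_bigr => i _.
  rewrite mulrC mulrAC mulrA mulrAC.
  by congr (_ * _).
have S0 : 0 <= S.
  by rewrite divr_ge0// sumr_ge0// => i _; rewrite divr_ge0// ltW.
rewrite -(ler_pXn2r m0) ?nnegrE//; last by rewrite mulr_ge0// ltW.
rewrite exprMn cm; apply: (le_trans vz).
rewrite -ler_pdivrMl; last exact: prodr_gt0.
apply: le_trans AG; rewrite big_split/= mulrC.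
by rewrite ler_wpM2l// ?prodr_ge0// -prodfV.
Qed.

(** A vanishing integral of some g_i forces u = 0 almost everywhere, and an
    infinite one makes the right-hand side infinite when no other integral
    vanishes.  In the remaining case, u is bounded pointwise by
    c * sum_i g_i / (m a_i), where a_i is the integral of g_i and c the
    geometric mean of the a_i; this bound has integral c. *)
Lemma integral_prod_holder d (T : measurableType d) (R : realType)
    (mu : {measure set T -> \bar R}) (D : set T) (m : nat)
    (g : 'I_m -> T -> \bar R) (u : T -> \bar R) :
  (0 < m)%N -> measurable D ->
  (forall i, measurable_fun D (g i)) -> measurable_fun D u ->
  (forall i x, D x -> 0 <= g i x)%E -> (forall x, D x -> 0 <= u x)%E ->
  (forall x, D x -> u x ^+ m <= \prod_(i < m) g i x)%E ->
  ((\int[mu]_(x in D) u x) ^+ m <= \prod_(i < m) \int[mu]_(x in D) g i x)%E.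
Proof.
move=> m0 mD mg mu_ g0 u0 ug.
have G0 i : (0 <= \int[mu]_(x in D) g i x)%E by apply: integral_ge0 => x /g0.
have [/existsP[i /eqP Gi]|] :=
    boolP [exists i, (\int[mu]_(x in D) g i x)%E == 0%E].
  rewrite (_ : (\int[mu]_(x in D) u x)%E = 0%E).
    rewrite (_ : 0 ^+ m = 0)%E; first exact: prode_ge0.
    by apply/eqP; rewrite expe_eq0 m0 eqxx.
  have gi0 : ae_eq mu D (g i) (cst 0%E).
    apply/ae_eq_integral_abs => //; rewrite -Gi; apply: eq_integral => x.
    by rewrite inE => Dx; rewrite gee0_abs// g0.
  rewrite (@ge0_ae_eq_integral _ _ _ mu D u (cst 0%E))//.
    by rewrite integral0.
  apply: filterS gi0 => x gix Dx; have := ug _ Dx.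
  rewrite (bigD1 i)//= gix// mul0e => um; apply/eqP.
  have : (u x ^+ m == 0)%E by rewrite eq_le um expe_ge0// u0.
  by rewrite expe_eq0 m0.
move=> /existsPn Gn0.
have Gp i : (0 < \int[mu]_(x in D) g i x)%E by rewrite lt_neqAle eq_sym Gn0 G0.
have prodgt0 P : (0 < \prod_(i < m | P i) \int[mu]_(x in D) g i x)%E.
  by elim/big_ind : _ => //= x y; exact: mule_gt0.
have [/existsP[i /eqP Gi]|] :=
    boolP [exists i, (\int[mu]_(x in D) g i x)%E == +oo%E].
  by rewrite (bigD1 i)//= Gi gt0_mulye ?leey.
move=> /existsPn Gfin.
pose a i := fine (\int[mu]_(x in D) g i x)%E.
have aE i : (\int[mu]_(x in D) g i x)%E = (a i)%:E.
  by rewrite fineK// ge0_fin_numE// ltey.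
have a0 i : 0 < a i by rewrite -lte_fin -aE.
pose c := (\prod_(i < m) a i) `^ m%:R^-1.
have c0 : 0 < c by rewrite powR_gt0// prodr_gt0.
have cm : c ^+ m = \prod_(i < m) a i.
  rewrite -powR_mulrn; last exact: ltW.
  rewrite -powRrM mulVf ?pnatr_eq0 -?lt0n//.
  by rewrite powRr1// prodr_ge0// => i _; rewrite ltW.
under eq_bigr do rewrite aE.
rewrite prodEFin -cm EFin_expe; apply: lee_expe; first exact: integral_ge0.
have w0 i : (0 <= (m%:R^-1 / a i)%:E)%E.
  by rewrite lee_fin divr_ge0 ?invr_ge0// ltW.
have mwg i : measurable_fun D (fun x => (m%:R^-1 / a i)%:E * g i x)%E.
  by apply: emeasurable_funM => //; exact: measurable_cst.
have wg0 i x : D x -> (0 <= (m%:R^-1 / a i)%:E * g i x)%E.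
  by move=> Dx; rewrite mule_ge0// g0.
have ms : measurable_fun D (fun x => \sum_(i < m) (m%:R^-1 / a i)%:E * g i x)%E.
  exact: emeasurable_sum.
have s0 x : D x -> (0 <= \sum_(i < m) (m%:R^-1 / a i)%:E * g i x)%E.
  by move=> Dx; apply: sume_ge0 => i _; exact: wg0.
apply: (@le_trans _ _
    (\int[mu]_(x in D) (c%:E * \sum_(i < m) (m%:R^-1 / a i)%:E * g i x))%E).
  apply: ge0_le_integral => //.
    by apply: emeasurable_funM => //; exact: measurable_cst.
  move=> x Dx; apply: le_scaled_arithmetic_mean => //; first exact: u0.
  - by move=> i; exact: g0.
  - exact: ug.
rewrite ge0_integralZl//; last by rewrite lee_fin ltW.
rewrite ge0_integral_sum//.
rewrite [X in (_ * X)%E](_ : _ = 1%E) ?mule1//.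
under eq_bigr => i _.
  rewrite ge0_integralZl//; last by move=> x; exact: g0.
  rewrite aE -EFinM divfK ?gt_eqF//; over.
rewrite sumEFin sumr_const card_ord.
by rewrite -[X in X%:E]mulr_natr mulVf ?pnatr_eq0 -?lt0n.
Qed.

(** * Homogeneity of volume *)

Lemma measurable_mull (R : realType) (t : R) :
  measurable_fun [set: measurableTypeR R]
    (fun x : R => t * x : measurableTypeR R).
Proof. by apply: measurable_funM => //; exact: measurable_cst. Qed.

(** Lebesgue measure in disguise: this form is the one to which the uniqueness
    of Lebesgue measure and the change of variables x |-> t * x apply. *)
Definition lebesgue_scale (R : realType) (t : R) (t0 : 0 < t) :
    {measure set (measurableTypeR R) -> \bar R} :=
  mscale (NngNum (ltW t0))
    (measure_function_pushforward__canonical__measure_function_Measure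
      (@lebesgue_measure R) (measurable_mull t)).

Lemma lebesgue_measure_scale (R : realType) (t : R) (A : set R) :
  0 < t -> measurable A ->
  (t%:E * lebesgue_measure ((fun x : R => t * x)%R @^-1` A) =
   lebesgue_measure A)%E.
Proof.
move=> t0 mA.
apply/esym/(@lebesgue_measure_unique _ (lebesgue_scale t0)) => //=.
move=> _ [[a b]] _ <-.
rewrite /lebesgue_scale /mscale/= /pushforward.
rewrite (_ : _ @^-1` _ = `]a / t, b / t]%classic); last first.
  by apply/seteqP; split => x /=;
    rewrite !in_itv/= ltr_pdivrMr// ler_pdivlMr// ![x * t]mulrC.
rewrite !lebesgue_measure_itv/= !lte_fin ltr_pM2r ?invr_gt0//.
by case: ifP => _; rewrite ?mule0// -!EFinD -EFinM -mulrBl mulrC divfK// gt_eqF.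
Qed.

Lemma measurable_scale (R : realType) (n : nat) (t : R) :
  measurable_fun setT (fun x : 'rV[R]_n => t *: x).
Proof.
apply: measurable_rVP => i; under eq_fun do rewrite mxE.
by apply: measurable_funM; [exact: measurable_cst|exact: measurable_rV_coord].
Qed.

(** By induction on the dimension: slicing along the first coordinate, the
    slice of the preimage at x is the preimage of the slice at t * x, which
    contributes t ^ n, and substituting x / t for x in the outer integral
    contributes the last factor t. *)
Lemma volume_scale (R : realType) (n : nat) (t : R) (A : set 'rV[R]_n) :
  0 < t -> measurable A ->
  ((t ^+ n)%:E * volume ((fun x => t *: x) @^-1` A) = volume A)%E.
Proof.
move=> t0; elim: n A => [|n ih] A mA.
  rewrite expr0 mul1e; congr volume; apply/seteqP; split => x /=;
  by rewrite (_ : t *: x = x)//; apply/rowP; case.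
rewrite /= /pushforward.
set B := @rV_cons R n @^-1` A.
have mB : measurable B.
  by rewrite -[B]setTI; exact: measurable_rV_cons.
pose phi := fun x => volume (xsection B x).
have mphi : measurable_fun setT phi by exact: measurable_fun_xsection.
have phi0 x : (0 <= phi x)%E by exact: measure_ge0.
rewrite [X in (_ * X)%E](_ : _ =
    (\int[lebesgue_measure]_x ((t ^- n)%:E * phi (t * x)%R))%E); last first.
  apply: eq_integral => x _ /=.
  rewrite /phi -(ih (xsection B (t * x))); last exact: measurable_xsection.
  rewrite muleA -EFinM mulVf ?mul1e ?expf_neq0 ?gt_eqF//.
  congr volume; apply/seteqP; split => y; rewrite /xsection/= !inE /B/=;
  by rewrite (_ : rV_cons (t * x, t *: y) = t *: rV_cons (x, y))//;
     apply/rowP => i; rewrite !mxE; case: unliftP => //= j _; rewrite mxE.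
have phit0 x : (0 <= phi (t * x)%R)%E by [].
rewrite ge0_integralZl//; last 2 first.
- exact: (measurableT_comp mphi (measurable_mull t)).
- by rewrite lee_fin invr_ge0 exprn_ge0// ltW.
rewrite muleA -EFinM exprS -mulrA divff ?expf_neq0 ?gt_eqF// mulr1.
transitivity (\int[lebesgue_scale t0]_x phi x)%E.
  rewrite ge0_integral_mscale// ge0_integral_pushforward//.
  exact: measurable_mull.
apply: eq_measure_integral => C mC _.
exact: lebesgue_measure_scale.
Qed.

(** * Measurability of the support function *)

(** A point of K is chosen in each cube that has a rational centre and a radius
    1 / (N + 1) and meets K. *)
Lemma exists_countable_dense (R : realType) (n : nat) (K : set 'rV[R]_n) :
  K !=set0 -> exists d : nat -> 'rV[R]_n, (forall k, K (d k)) /\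
    forall x (e : R), K x -> 0 < e ->
      exists k, forall i, `|x ord0 i - d k ord0 i| < e.
Proof.
move=> [x0 Kx0].
pose near (p : 'rV[rat]_n * nat) (x : 'rV[R]_n) :=
  K x /\ forall i, `|x ord0 i - ratr (p.1 ord0 i)| < p.2.+1%:R^-1.
pose d k := if unpickle k is Some p then xget x0 (near p) else x0.
exists d; split => [k|x e Kx e0].
  rewrite /d; case: unpickle => // p.
  by case: xgetP => // y _ [].
have e20 : 0 < e / 2 by rewrite divr_gt0.
have [N Ne] : exists N : nat, N.+1%:R^-1 < e / 2.
  exists (Num.truncn (e / 2)^-1).
  rewrite -[ltRHS]invrK ltf_pV2 ?posrE ?invr_gt0//.
  exact: truncnS_gt.
have /choice[q qx] : forall i, exists q : rat,
    `|x ord0 i - ratr q| < N.+1%:R^-1.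
  move=> i; have N0 : 0 < N.+1%:R^-1 :> R by rewrite invr_gt0.
  have : x ord0 i - N.+1%:R^-1 < x ord0 i + N.+1%:R^-1.
    by rewrite ltrBlDr -addrA ltrDl addr_gt0.
  move=> /rat_in_itvoo[q]; rewrite in_itv/= => /andP[q1 q2]; exists q.
  by rewrite distrC ltr_distl q1.
pose p : 'rV[rat]_n * nat := (\row_i q i, N).
exists (pickle p) => i; rewrite /d pickleK.
have px : near p x by split => // j; rewrite mxE.
case: xgetP => [y _ [_ /(_ i) yp]|/(_ x)//].
have /(_ i) xp := px.2.
rewrite [ltRHS]splitr; apply: le_lt_trans (ler_distD (ratr (p.1 ord0 i)) _ _) _.
by rewrite ltrD// ?(lt_trans xp)// distrC (lt_trans yp).
Qed.

(** Since the supremum may be taken over a countable dense subset, each set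
    h_K > a is a countable union of open half-spaces, or of trivial ones when
    0 is among the points. *)
Lemma measurable_support (R : realType) (n : nat) (K : set 'rV[R]_n) :
  K 0 -> measurable_fun setT (Defs.support K).
Proof.
move=> K0.
have [d [Kd dK]] := exists_countable_dense (ex_intro _ _ K0).
have md y : measurable_fun setT (fun theta : 'rV[R]_n => (dotp y theta)%:E).
  apply/measurable_EFinP; apply: measurable_sum => i; apply: measurable_funM.
    exact: measurable_cst.
  exact: measurable_rV_coord.
apply: (measurability _ (ErealGenOInfty.measurableE R)).
move=> _ [_ [a ->] <-].
rewrite (_ : _ `&` _ = \bigcup_k
    (setT `&` [set theta | (a%:E < (dotp (d k) theta)%:E)%E])).
  apply: bigcupT_measurable => k.
  exact: emeasurable_fun_o_infty.
apply/seteqP; split => theta /=.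
  rewrite in_itv/= andbT => -[_ /ereal_sup_gt[_ [x Kx <-]]].
  rewrite lte_fin => ax.
  (* The added 1 keeps S positive even when theta = 0. *)
  pose S := \sum_(i < n) `|theta ord0 i| + 1.
  have S0 : 0 < S by rewrite ltr_wpDl// sumr_ge0.
  have e0 : 0 < (dotp x theta - a) / S by rewrite divr_gt0// subr_gt0.
  have [k xk] := dK x _ Kx e0.
  exists k => //; split => //=; rewrite lte_fin.
  rewrite -(ltrD2l (dotp x theta - dotp (d k) theta)) subrK -ltrBrDr.
  rewrite /dotp -sumrB.
  apply: (@le_lt_trans _ _
    (\sum_(i < n) ((dotp x theta - a) / S * `|theta ord0 i|))).
    apply: ler_sum => i _; rewrite -mulrBl; apply: le_trans (ler_norm _) _.
    by rewrite normrM ler_wpM2r// ltW.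
  rewrite -mulr_sumr -mulrA gtr_pMr ?subr_gt0// mulrC ltr_pdivrMr// mul1r.
  by rewrite /S ltrDl.
move=> [k _ [_ /=]] ak; split => //; rewrite in_itv/= andbT.
by apply: (lt_le_trans ak); apply: ereal_sup_ubound; exists (d k).
Qed.

(** * Volume of a flower *)

Import HBNNSimple.

(** The factor c, rather than the n-th power of a radius, is what appears
    when cones are truncated along the level sets of a function below
    h_K ^ n. *)
Lemma volume_cone (R : realType) (n : nat) (c : R) (E : set 'rV[R]_n) :
  (0 < n)%N -> 0 < c -> measurable E ->
  (volume (@direction R n @^-1` E `&` [set x | (enorm x ^+ n <= c)%R]) =
   c%:E * volume (@eball R n `&` @direction R n @^-1` E))%E.
Proof.
move=> n0 c0 mE; set t := c `^ n%:R^-1.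
have t0 : 0 < t by exact: powR_gt0.
have tn : t ^+ n = c.
  rewrite -powR_mulrn; last exact: ltW.
  by rewrite -powRrM mulVf ?pnatr_eq0 -?lt0n// powRr1// ltW.
have mcone : measurable (@direction R n @^-1` E).
  by rewrite -[X in measurable X]setTI; exact: measurable_direction.
have mball : measurable [set x : 'rV[R]_n | enorm x ^+ n <= c].
  rewrite -[X in measurable X]setTI; apply: measurable_fun_le => //.
  by apply: measurable_funX; exact: measurable_enorm.
rewrite -(volume_scale t0); last exact: measurableI.
rewrite tn; congr (_ * volume _)%E; apply/seteqP.
have eqv (x : 'rV[R]_n) : (enorm (t *: x) ^+ n <= c) = (enorm x <= 1).
  rewrite enormZ gtr0_norm// exprMn tn -ler_pdivlMl// mulVf ?gt_eqF//.
  by rewrite expr_le1 ?enorm_ge0.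
by split => x /=; rewrite eqv directionZ// => -[].
Qed.

(** The integral is the supremum of the integrals of the simple functions g
    below h_K ^ n on the sphere; the level set of g at c > 0 is the base of
    the cone truncated by |x| ^ n <= c, which lies in the flower, and the
    cones over different level sets are disjoint. *)
Lemma flower_volume_ge (R : realType) (n : nat) (K : set 'rV[R]_n) :
  (0 < n)%N -> K 0 ->
  (volume (@eball R n) *
   \int[@sphere_measure R n]_(theta in @esphere R n) (Defs.support K theta ^+ n)
   <= volume (flower K))%E.
Proof.
move=> n0 K0; have h0 theta := @support_ge0 R n K theta K0.
set b := volume (@eball R n).
have b_gt0 : (0 < b)%E by exact: volume_eball_gt0.
have b_lty : (b < +oo)%E by exact: volume_eball_lty.
have bfin : b \is a fin_num by rewrite gt0_fin_numE.
have b0 : 0 < fine b by rewrite fine_gt0// b_gt0.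
rewrite muleC -(fineK bfin) -lee_pdivlMr//.
have mF : measurable (flower K).
  rewrite flowerE// -[X in measurable X]setTI; apply: measurable_lee => //.
    by apply/measurable_EFinP; exact: measurable_enorm.
  exact: measurableT_comp (measurable_support K0) (@measurable_direction R n).
rewrite ge0_integralE; last by move=> theta _; exact: expe_ge0.
apply: ge_ereal_sup => _ [g /= gh <-].
rewrite lee_pdivlMr// fineK// muleC sintegralEnnsfun.
pose P c := @direction R n @^-1` (g @^-1` [set c]) `&`
  [set x | (enorm x ^+ n <= c)%R].
pose C := range g `&` [set c | 0 < c].
have mg (c : R) : measurable (g @^-1` [set c]).
  by rewrite -[X in measurable X]setTI; exact: measurable_funP.
(* Only the finitely many values that g takes contribute to the sum. *)
rewrite -(fsbig_widen C); last 2 first.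
- by move=> c [].
- move=> c [/= c0 nCc]; rewrite preimage10 ?measure0 ?mule0// => -[x _ gx].
  by apply: nCc; split => //; exists x.
have finC : finite_set C by exact: finite_setIl.
rewrite ge0_mule_fsumr; last by move=> c; exact: nnsfun_mulemu_ge0.
rewrite (eq_fsbigr (fun c => volume (P c))); last first.
  move=> c; rewrite inE => -[_ /= c0]; rewrite /P volume_cone//.
  rewrite /= /sphere_measure muleCA; congr (_ * _)%E; rewrite -/b.
  by rewrite muleA -{1}(fineK bfin) -EFinM divff ?mul1e// gt_eqF.
have mP c : C c -> measurable (P c).
  move=> _; apply: measurableI.
    by rewrite -[X in measurable X]setTI; exact: measurable_direction.
  rewrite -[X in measurable X]setTI; apply: measurable_fun_le => //.
  by apply: measurable_funX; exact: measurable_enorm.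
rewrite -measure_fin_bigcup//; last first.
  by move=> c c' _ _ [x [[/= <- _] [<- _]]].
apply: le_measure; rewrite ?inE//.
  by apply: fin_bigcup_measurable.
move=> x [c [_ /= c0] [/= gx xc]].
rewrite flowerE//=; have := gh (direction x); rewrite gx patchE.
(* Off the sphere, in particular in the direction assigned to x = 0, the
   function g vanishes, so the cones do not contain such points. *)
case: ifPn => [/set_mem Sx cx|_]; last by rewrite lee_fin leNgt c0.
have : ((enorm x)%:E ^+ n <= Defs.support K (direction x) ^+ n)%E.
  by rewrite -EFin_expe (le_trans _ cx)// lee_fin.
have e0 : (0 <= (enorm x)%:E)%E by rewrite lee_fin enorm_ge0.
by move/(le_expe_poweR n0 e0); rewrite expe_poweRK.
Qed.
(** * Mixed flower volumes *)

Lemma mixed_flower_volume_ge0 (R : realType) (n : nat)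
    (K : 'I_n -> set 'rV[R]_n) :
  (forall i, K i 0) -> (0 <= mixed_flower_volume K)%E.
Proof.
move=> K0; apply: mule_ge0 => //; apply: integral_ge0 => theta _.
by apply: prode_ge0 => i _; exact: support_ge0.
Qed.

Lemma mixed_flower_volume_holder (R : realType) (n m : nat)
    (K : 'I_n -> set 'rV[R]_n) (L : 'I_m -> 'I_n -> set 'rV[R]_n) :
  (0 < m)%N -> (forall i, K i 0) -> (forall j i, L j i 0) ->
  (forall theta, (\prod_(i < n) Defs.support (K i) theta) ^+ m <=
    \prod_(j < m) \prod_(i < n) Defs.support (L j i) theta)%E ->
  (mixed_flower_volume K ^+ m <= \prod_(j < m) mixed_flower_volume (L j))%E.
Proof.
move=> m0 K0 L0 KL.
have msupp (M : 'I_n -> set 'rV[R]_n) : (forall i, M i 0) ->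
    measurable_fun (@esphere R n)
      (fun theta => \prod_(i < n) Defs.support (M i) theta)%E.
  move=> M0; apply: measurable_prode => i.
  by apply: measurable_funTS; exact: measurable_support.
rewrite /mixed_flower_volume expeMn big_split/= prode_constE.
apply: lee_wpmul2l; first by rewrite expe_ge0.
apply: integral_prod_holder => //; first exact: measurable_esphere.
- by move=> j; exact: msupp.
- exact: msupp.
- by move=> j theta _; apply: prode_ge0 => i _; exact: support_ge0.
- by move=> theta _; apply: prode_ge0 => i _; exact: support_ge0.
Qed.

Theorem proposition49 (R : realType) (n : nat) (n_gt0 : (0 < n)%N)
    (K : 'I_n -> set 'rV[R]_n) (hK : forall i, convex_body (K i)) :
  (forall n_gt1 : (1 < n)%N,
     let i1 : 'I_n := Ordinal n_gt0 in
     let i2 : 'I_n := Ordinal n_gt1 in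
     (mixed_flower_volume K ^+ 2 <=
      mixed_flower_volume [eta K with i2 |-> K i1] *
      mixed_flower_volume [eta K with i1 |-> K i2])%E) /\
  (mixed_flower_volume K <=
   (\prod_(i < n) volume (flower (K i))) `^ (n%:R^-1))%E.
Proof.
have K0 i : K i 0 by case: (hK i).
split=> [n_gt1|].
  move=> /=; set i1 := Ordinal n_gt0; set i2 := Ordinal n_gt1.
  pose L (j : 'I_2) :=
    if j == ord0 then [eta K with i2 |-> K i1] else [eta K with i1 |-> K i2].
  have prod2 (f : 'I_2 -> \bar R) :
      (\prod_(j < 2) f j = f ord0 * f (lift ord0 ord0))%E.
    by rewrite !big_ord_recl big_ord0 mule1.
  suff : (mixed_flower_volume K ^+ 2 <=
      \prod_(j < 2) mixed_flower_volume (L j))%E.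
    by rewrite prod2.
  apply: mixed_flower_volume_holder => // [j i|theta].
    by rewrite /L; case: ifP => _ /=; case: ifP.
  rewrite expe2 prod2 /L/=.
  have split12 (M : 'I_n -> set 'rV[R]_n) :
      (forall i, i != i1 -> i != i2 -> M i = K i) ->
      (\prod_(i < n) Defs.support (M i) theta =
       Defs.support (M i1) theta * Defs.support (M i2) theta *
       \prod_(i < n | (i != i1) && (i != i2)) Defs.support (K i) theta)%E.
    move=> MK; rewrite (bigD1 i1)//= (bigD1 i2)//= muleA; congr (_ * _)%E.
    by apply: eq_bigr => i /andP[i1i i2i]; rewrite MK.
  rewrite (split12 K)// !split12/= ?eqxx//; last 2 first.
  - by move=> i /negbTE ->.
  - by move=> i _ /negbTE ->.
  by rewrite muleACA [leRHS]muleACA (muleACA (Defs.support (K i1) theta)).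
apply: le_expe_poweR => //; first exact: mixed_flower_volume_ge0.
apply: (@le_trans _ _
    (\prod_(j < n) mixed_flower_volume (fun _ : 'I_n => K j))%E).
  apply: mixed_flower_volume_holder => // theta.
  by rewrite prode_expe; under [leRHS]eq_bigr do rewrite prode_constE.
apply: lee_prode => j; rewrite mixed_flower_volume_ge0//=.
apply: le_trans (flower_volume_ge n_gt0 (K0 j)).
by rewrite /mixed_flower_volume; under eq_integral do rewrite prode_constE.
Qed.
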